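(* Let $m\ge 1$ and $r$ be integers with $\lceil \frac{m-1}{2}\rceil \le r < m$. Then the codewords $|\mathbf w\rangle_{r,m}$ of $\mathrm{QRM}(r,m)$ on $2^m$ qubits can be written as a superposition of tensor products of codewords of $\mathrm{QRM}(r,m-1)$ on the first $2^{m-1}$ qubits and on the last $2^{m-1}$ qubits. Explicitly, for $\mathbf w=(\mathbf w_1,\mathbf w_2)\in \mathrm{RM}(r,m)$ with $\mathbf w_1,\mathbf w_2\in \mathrm{RM}(r,m-1)$, $$|\mathbf w\rangle_{r,m}=\frac{1}{\sqrt{|B|}}\sum_{\mathbf u\in B}|\mathbf w_1\oplus\mathbf u\rangle_{r,m-1}\otimes|\mathbf w_2\oplus \mathbf u\rangle_{r,m-1},$$ where $B=\mathrm{RM}(m-r-1,m-1)/\mathrm{RM}(m-r-2,m-1)$ is a quotient set (the sum runs over one representative $\mathbf u$ of each coset).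
   Context: For $0\le r\le m$, $\mathrm{RM}(r,m)\subseteq\mathbb F_2^{2^m}$ is the binary Reed-Muller code: the set of evaluation vectors $\mathrm{Eval}^{(m)}(f)=(f(\boldsymbol\rho(1)),\dots,f(\boldsymbol\rho(2^m)))$ of polynomials $f\in\mathbb F_2[x_1,\dots,x_m]$ of degree at most $r$, where $\boldsymbol\rho(j)\in\mathbb F_2^m$ is the $m$-bit binary representation of $j-1$ (first coordinate most significant). Set $\mathrm{RM}(s,m)=\{\mathbf 0\}$ for $s<0$. $\oplus$ is addition in $\mathbb F_2^n$, and $|\mathbf b\rangle$ is the computational basis state of $n$ qubits for $\mathbf b\in\mathbb F_2^n$. One has $\mathrm{RM}(r,m)^\perp=\mathrm{RM}(m-r-1,m)$. For $r\ge (m-1)/2$, $\mathrm{QRM}(r,m)$ is the CSS code on $2^m$ qubits spanned by the states, for $\mathbf w\in\mathrm{RM}(r,m)$, $$|\mathbf w\rangle_{r,m}=\frac{1}{\sqrt{|\mathrm{RM}(r,m)^\perp|}}\sum_{\mathbf c\in \mathrm{RM}(r,m)^\perp}|\mathbf w\oplus\mathbf c\rangle .$$ *)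

(* Defs.v *)
From HB Require Import structures.
From mathcomp Require Import all_boot all_order all_algebra.
From mathcomp Require Import boolp.
From mathcomp Require Import mpoly.

Set Implicit Arguments.
Unset Strict Implicit.
Unset Printing Implicit Defensive.

Import Order.TTheory GRing.Theory Num.Theory.
Local Open Scope ring_scope.

(* Bit i of the m-bit binary expansion of j, most significant bit first.
   Indices are 0-based: j : 'I_(2 ^ m) is the (j+1)-st evaluation point. *)
Definition rho (m : nat) (j : 'I_(2 ^ m)) (i : 'I_m) : 'F_2 :=
  (odd (j %/ 2 ^ (m - i.+1)))%:R.

Definition Eval (m : nat) (f : {mpoly 'F_2[m]}) : 'rV['F_2]_(2 ^ m) :=
  \row_j f.@[@rho m j].

(* msize f is 1 + deg f, and 0 when f = 0. *)
Definition RM (s : int) (m : nat) : {set 'rV['F_2]_(2 ^ m)} :=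
  match s with
  | Posz r => [set v : 'rV['F_2]_(2 ^ m) | `[< exists f : {mpoly 'F_2[m]},
                             (msize f <= r.+1)%N /\ v = Eval f >]]
  | Negz _ => [set 0]
  end.

Definition dual (n : nat) (A : {set 'rV['F_2]_n}) : {set 'rV['F_2]_n} :=
  [set v : 'rV['F_2]_n | [forall w in A, \sum_(i < n) v 0 i * w 0 i == 0]].

(* The state space of n qubits: a state is given by its amplitudes in the
   computational basis. The scalars C range over all fields that behave like
   the complex numbers (in particular R[i] for any realType R). *)
Notation state C n := {ffun 'rV['F_2]_n -> C^o}.

Definition ket (C : numClosedFieldType) (n : nat) (b : 'rV['F_2]_n) :
    state C n :=
  [ffun x => (x == b)%:R].

Definition tensor (C : numClosedFieldType) (n1 n2 : nat)
    (psi : state C n1) (phi : state C n2) : state C (n1 + n2) :=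
  [ffun b => psi (lsubmx b) * phi (rsubmx b)].

Definition cast_state (C : numClosedFieldType) (n n' : nat) (e : n = n')
    (psi : state C n) : state C n' :=
  [ffun b => psi (castmx (erefl, esym e) b)].

Definition qrm_ket (C : numClosedFieldType) (r : int) (m : nat)
    (w : 'rV['F_2]_(2 ^ m)) : state C (2 ^ m) :=
  (sqrtC #|dual (RM r m)|%:R)^-1 *: \sum_(c in dual (RM r m)) ket C (w + c).

Definition QRM (C : numClosedFieldType) (r : int) (m : nat) :
    {vspace state C (2 ^ m)} :=
  <<[seq qrm_ket C r w | w in RM r m]>>%VS.

Definition coset_partition (n : nat) (G H : {set 'rV['F_2]_n}) :
    {set {set 'rV['F_2]_n}} :=
  equivalence_partition [rel u v | u - v \in H] G.

Lemma halves (m : nat) : (0 < m)%N -> (2 ^ m.-1 + 2 ^ m.-1)%N = (2 ^ m)%N.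
Proof. by case: m => // m _; rewrite addnn -mul2n -expnS. Qed.

Definition concat (m : nat) (hm : (0 < m)%N) (w1 w2 : 'rV['F_2]_(2 ^ m.-1)) :
    'rV['F_2]_(2 ^ m) :=
  castmx (erefl, halves hm) (row_mx w1 w2).

Definition tensor_halves (C : numClosedFieldType) (m : nat) (hm : (0 < m)%N)
    (psi phi : state C (2 ^ m.-1)) : state C (2 ^ m) :=
  cast_state (halves hm) (tensor psi phi).

(* Main.v *)
(* Over F_2, Plotkin's decomposition reads: (a, b) is in RM(s, n+1) iff a is in
   RM(s, n) and b - a is in RM(s-1, n). Applied to RM(r, m)^perp = RM(m-r-1, m),
   whose own proof is an induction on m through the same decomposition, it shows
   that RM(r, m)^perp is the disjoint union, over representatives u of
   K = RM(m-r-1, m-1) modulo H = RM(m-r-2, m-1), of the products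
   (u + H) x (u + H). Since H = RM(r, m-1)^perp, the sum defining |w>_{r,m}
   splits accordingly, and |RM(r, m)^perp| = |K/H| |H|^2 matches the
   normalisations. *)
Require Import Defs.
From HB Require Import structures.
From mathcomp Require Import all_boot all_order all_algebra.
From mathcomp Require Import boolp.
From mathcomp Require Import mpoly.
From mathcomp Require Import zify.

Set Implicit Arguments.
Unset Strict Implicit.
Unset Printing Implicit Defensive.

Import Order.TTheory GRing.Theory Num.Theory.
Local Open Scope ring_scope.

(** * Binary words and the additive structure of Reed-Muller codes *)

Lemma addvv_F2 (n : nat) (v : 'rV['F_2]_n) : v + v = 0.
Proof. by apply/rowP=> i; rewrite !mxE addrr_pchar2 // pchar_Fp. Qed.

Lemma oppv_F2 (n : nat) (v : 'rV['F_2]_n) : - v = v.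
Proof. by apply/eqP; rewrite eq_sym -addr_eq0 addvv_F2. Qed.

Lemma F2_eq01 (c : 'F_2) : c = 0 \/ c = 1.
Proof. by case: c => [[|[|k]] hk] //; [left | right]; apply/val_inj. Qed.

Lemma EvalD (m : nat) (f g : {mpoly 'F_2[m]}) : Eval (f + g) = Eval f + Eval g.
Proof. by apply/rowP=> j; rewrite !mxE mevalD. Qed.

Lemma Eval0 (m : nat) : Eval (0 : {mpoly 'F_2[m]}) = 0.
Proof. by apply/rowP=> j; rewrite !mxE meval0. Qed.

Lemma RM0 (s : int) (m : nat) : 0 \in RM s m.
Proof.
case: s => [r|r] /=; rewrite inE //.
by apply/asboolP; exists 0; rewrite msize0 Eval0.
Qed.

Lemma RMD (s : int) (m : nat) (v w : 'rV['F_2]_(2 ^ m)) :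
  v \in RM s m -> w \in RM s m -> v + w \in RM s m.
Proof.
case: s => [r|r] /=; rewrite !inE; last by move=> /eqP-> /eqP->; rewrite addr0.
move=> /asboolP[f [hf ->]] /asboolP[g [hg ->]].
apply/asboolP; exists (f + g); split; last by rewrite EvalD.
by apply: leq_trans (msizeD_le _ _) _; rewrite geq_max hf hg.
Qed.

Lemma RMB (s : int) (m : nat) (v w : 'rV['F_2]_(2 ^ m)) :
  v \in RM s m -> w \in RM s m -> v - w \in RM s m.
Proof. by rewrite oppv_F2; apply: RMD. Qed.

Lemma RM_monomial (s : int) (m : nat) (mu : 'X_{1..m}) :
  (mdeg mu)%:Z <= s -> Eval 'X_[mu] \in RM s m.
Proof.
case: s => [r|r] //= hr; rewrite inE; apply/asboolP; exists 'X_[mu].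
by rewrite msizeX; split=> //; rewrite ltnS.
Qed.

(** Coefficients in ['F_2] are 0 or 1, so a polynomial is a plain sum of the monomials of its
    support, all of degree at most [s]. This is the induction principle for inclusions of codes:
    only monomials need checking. *)
Lemma RM_sub_additive (s : int) (m : nat) (S : {set 'rV['F_2]_(2 ^ m)}) :
    0 \in S -> {in S &, forall v w, v + w \in S} ->
    (forall mu : 'X_{1..m}, (mdeg mu)%:Z <= s -> Eval 'X_[mu] \in S) ->
  {subset RM s m <= S}.
Proof.
move=> S0 SD SX v; case: s SX => [r|r] SX; rewrite inE; last by move=> /eqP->.
case/asboolP=> f [hf ->]; rewrite (mpolyE f) big_seq.
elim/big_ind: _ => [|g h Sg Sh|mu hmu]; first by rewrite Eval0.
  by rewrite EvalD; apply: SD.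
have [->|->] := F2_eq01 f@_mu; first by rewrite scale0r Eval0.
rewrite scale1r; apply: SX; rewrite lez_nat -ltnS.
exact: leq_trans (msize_mdeg_lt hmu) hf.
Qed.

Lemma RM_mono (s t : int) (m : nat) : s <= t -> {subset RM s m <= RM t m}.
Proof.
move=> st; apply: RM_sub_additive (@RM0 _ _) (@RMD _ _) _ => mu hmu.
exact/RM_monomial/(le_trans hmu).
Qed.

(** * The bilinear form behind [dual] *)

Definition dot (n : nat) (v w : 'rV['F_2]_n) : 'F_2 := \sum_i v 0 i * w 0 i.

Lemma dotDl (n : nat) (u v w : 'rV['F_2]_n) : dot (u + v) w = dot u w + dot v w.
Proof. by rewrite -big_split; apply: eq_bigr => i _; rewrite mxE mulrDl. Qed.

Lemma dotDr (n : nat) (u v w : 'rV['F_2]_n) : dot u (v + w) = dot u v + dot u w.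
Proof. by rewrite -big_split; apply: eq_bigr => i _; rewrite mxE mulrDr. Qed.

Lemma dot0l (n : nat) (v : 'rV['F_2]_n) : dot 0 v = 0.
Proof. by rewrite /dot big1 // => i _; rewrite mxE mul0r. Qed.

Lemma dot0r (n : nat) (v : 'rV['F_2]_n) : dot v 0 = 0.
Proof. by rewrite /dot big1 // => i _; rewrite mxE mulr0. Qed.

(** * Splitting words into halves, and Plotkin's decomposition *)

Section Concat.
Variable n : nat.
Hypothesis hn : (0 < n.+1)%N.
Implicit Types a b c d : 'rV['F_2]_(2 ^ n).

Let lo (j : 'I_(2 ^ n)) : 'I_(2 ^ n.+1) := cast_ord (halves hn) (lshift _ j).
Let hi (j : 'I_(2 ^ n)) : 'I_(2 ^ n.+1) := cast_ord (halves hn) (rshift _ j).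

Lemma concat_lo a b j : concat hn a b 0 (lo j) = a 0 j.
Proof. by rewrite castmxE cast_ord_id cast_ordK row_mxEl. Qed.

Lemma concat_hi a b j : concat hn a b 0 (hi j) = b 0 j.
Proof. by rewrite castmxE cast_ord_id cast_ordK row_mxEr. Qed.

Lemma concat_of (w : 'rV['F_2]_(2 ^ n.+1)) :
  w = concat hn (\row_j w 0 (lo j)) (\row_j w 0 (hi j)).
Proof.
apply/rowP=> i; rewrite castmxE cast_ord_id.
rewrite -[i in LHS](cast_ordKV (halves hn)).
case: (fintype.splitP (cast_ord (esym (halves hn)) i)) => j e.
  have -> : cast_ord (esym (halves hn)) i = lshift _ j by apply: val_inj.
  by rewrite row_mxEl mxE.
have -> : cast_ord (esym (halves hn)) i = rshift _ j by apply: val_inj.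
by rewrite row_mxEr mxE.
Qed.

Lemma concatP (w : 'rV['F_2]_(2 ^ n.+1)) : exists a b, w = concat hn a b.
Proof. by eexists; eexists; apply: concat_of. Qed.

Lemma concat_inj a b c d : concat hn a b = concat hn c d -> a = c /\ b = d.
Proof.
move=> e; split; apply/rowP=> j.
  by rewrite -[LHS](concat_lo a b) e concat_lo.
by rewrite -[LHS](concat_hi a b) e concat_hi.
Qed.

Lemma concat_eq a b c d :
  (concat hn a b == concat hn c d) = (a == c) && (b == d).
Proof.
by apply/eqP/andP=> [/concat_inj[-> ->]|[/eqP-> /eqP->]].
Qed.

Lemma concatD a b c d :
  concat hn (a + c) (b + d) = concat hn a b + concat hn c d.
Proof.
rewrite [RHS]concat_of; congr concat; apply/rowP=> j; rewrite !mxE.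
  by rewrite !concat_lo.
by rewrite !concat_hi.
Qed.

Lemma concat0 : concat hn 0 0 = 0.
Proof.
by rewrite [RHS]concat_of; congr concat; apply/rowP=> j; rewrite !mxE.
Qed.

Lemma dot_concat a b c d :
  dot (concat hn a b) (concat hn c d) = dot a c + dot b d.
Proof.
rewrite /dot (reindex (cast_ord (halves hn))) /=; last first.
  exists (cast_ord (esym (halves hn))) => i _.
    by rewrite cast_ordK.
  by rewrite cast_ordKV.
rewrite big_split_ord /=; congr (_ + _); apply: eq_bigr => j _.
  by rewrite -/(lo j) !concat_lo.
by rewrite -/(hi j) !concat_hi.
Qed.

(** The first variable is the most significant bit, of weight [2 ^ n]: it separates the two halves,
    while the other bits agree on them. *)
Lemma rho_lo0 j : rho (lo j) ord0 = 0.
Proof. by rewrite /rho /= subSS subn0 divn_small. Qed.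

Lemma rho_hi0 j : rho (hi j) ord0 = 1.
Proof.
by rewrite /rho /= subSS subn0 divnDl ?dvdnn // divnn expn_gt0 divn_small.
Qed.

Lemma rho_loS j i : rho (lo j) (lift ord0 i) = rho j i.
Proof. by rewrite /rho /= /bump /= add1n subSS. Qed.

Lemma rho_hiS j i : rho (hi j) (lift ord0 i) = rho j i.
Proof.
rewrite /rho /= /bump /= add1n subSS; congr (nat_of_bool _)%:R.
(* Moving to the last half adds [2 ^ n], hence adds [2 ^ i.+1] to the quotient by [2 ^ (n - i.+1)].
   This is even, so the parity is unchanged. *)
have e : (2 ^ n = 2 ^ i.+1 * 2 ^ (n - i.+1))%N.
  by rewrite -expnD subnKC.
by rewrite {1}e divnMDl ?expn_gt0 // oddD oddX.
Qed.

Definition mnm_cons (k : nat) (mu : 'X_{1..n}) : 'X_{1..n.+1} :=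
  [multinom oapp mu k (unlift ord0 i) | i < n.+1].

Lemma mnm_cons0 k mu : mnm_cons k mu ord0 = k.
Proof. by rewrite mnmE unlift_none. Qed.

Lemma mnm_consS k mu i : mnm_cons k mu (lift ord0 i) = mu i.
Proof. by rewrite mnmE liftK. Qed.

Lemma mdeg_cons k mu : mdeg (mnm_cons k mu) = (k + mdeg mu)%N.
Proof.
rewrite !mdegE big_ord_recl mnm_cons0; congr addn.
by apply: eq_bigr => i _; rewrite mnm_consS.
Qed.

Lemma mnm_consP (mu : 'X_{1..n.+1}) : exists k nu, mu = mnm_cons k nu.
Proof.
exists (mu ord0), [multinom mu (lift ord0 i) | i < n]; apply/mnmP=> i.
by case: (unliftP ord0 i) => [j|] ->; rewrite ?mnm_consS ?mnm_cons0 ?mnmE.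
Qed.

(** The first variable is 1 on the last half and 0 on the first one, where its [k]-th power survives
    only as the empty product [k = 0]. *)
Lemma Eval_cons k (mu : 'X_{1..n}) :
  Eval 'X_[mnm_cons k mu]
    = concat hn (Eval 'X_[mu] *+ (k == 0%N)) (Eval 'X_[mu]).
Proof.
rewrite [LHS]concat_of; congr concat; apply/rowP=> j; rewrite ?mulmxnE !mxE.
  rewrite !mevalX big_ord_recl mnm_cons0 rho_lo0 expr0n.
  under eq_bigr do rewrite rho_loS mnm_consS.
  by rewrite mulr_natl.
rewrite !mevalX big_ord_recl mnm_cons0 rho_hi0 expr1n mul1r.
by under eq_bigr do rewrite rho_hiS mnm_consS.
Qed.

(** A monomial without the first variable evaluates to a word [(c, c)]. One containing it gives
    [(0, c)], where [c] comes from a monomial of smaller degree. These two shapes generate the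
    code. *)
Lemma RM_concat (s : int) a b :
  (concat hn a b \in RM s n.+1) = (a \in RM s n) && (b - a \in RM (s - 1) n).
Proof.
rewrite oppv_F2; apply/idP/andP.
  pose S := [set concat hn c d | c in RM s n,
                d in [set d | d + c \in RM (s - 1) n]].
  have inS c d : c \in RM s n -> d + c \in RM (s - 1) n -> concat hn c d \in S.
    by move=> hc hd; apply/imset2P; exists c d; rewrite ?inE.
  suff sub : {subset RM s n.+1 <= S}.
    by move=> /sub/imset2P[c d hc]; rewrite inE => hd /concat_inj[-> ->].
  apply: RM_sub_additive.
  - by rewrite -concat0; apply: inS; rewrite ?addr0 RM0.
  - move=> _ _ /imset2P[c d hc + ->] /imset2P[c' d' hc' + ->].
    rewrite !inE => hd hd'; rewrite -concatD; apply: inS; first exact: RMD.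
    by rewrite addrACA; apply: RMD.
  - move=> mu; have [k [nu ->]] := mnm_consP mu; rewrite mdeg_cons Eval_cons.
    (* Polynomials are not reduced modulo squares, so any positive exponent may occur; it lowers the
       degree of [nu] by at least one. *)
    case: k => [|k] hs; apply: inS;
      rewrite ?mulr1n ?mulr0n ?addr0 ?addvv_F2 ?RM0 //.
      exact: RM_monomial.
    by apply: RM_monomial; lia.
move=> [ha hb].
(* For the converse, the word splits into the two shapes, and each is lifted by multiplying
   monomials by the first variable to the power 0 or 1. *)
have -> : concat hn a b = concat hn a a + concat hn 0 (b + a).
  by rewrite -concatD addr0 addrCA addvv_F2 addr0.
have diag c : c \in RM s n -> concat hn c c \in RM s n.+1.
  move=> hc; have: c \in [set c | concat hn c c \in RM s n.+1].
    apply: RM_sub_additive hc => [|c1 c2|mu hmu]; rewrite !inE.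
    - by rewrite concat0 RM0.
    - by rewrite concatD; apply: RMD.
    - have := Eval_cons 0 mu; rewrite mulr1n => <-.
      by apply/RM_monomial; rewrite mdeg_cons.
  by rewrite inE.
have right c : c \in RM (s - 1) n -> concat hn 0 c \in RM s n.+1.
  move=> hc; have: c \in [set c | concat hn 0 c \in RM s n.+1].
    apply: RM_sub_additive hc => [|c1 c2|mu hmu]; rewrite !inE.
    - by rewrite concat0 RM0.
    - have -> : concat hn 0 (c1 + c2) = concat hn 0 c1 + concat hn 0 c2.
        by rewrite -concatD addr0.
      exact: RMD.
    - have := Eval_cons 1 mu; rewrite mulr0n => <-; apply/RM_monomial.
      by rewrite mdeg_cons; lia.
  by rewrite inE.
by apply: RMD; [apply: diag | apply: right].
Qed.

End Concat.

(** * Duality of Reed-Muller codes *)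

Lemma dualP (n : nat) (A : {set 'rV['F_2]_n}) (v : 'rV['F_2]_n) :
  reflect {in A, forall w, dot v w = 0} (v \in dual A).
Proof.
rewrite inE; apply: (iffP forall_inP) => h w hw; first exact/eqP/h.
exact/eqP/h.
Qed.

(** Without variables there is a single evaluation point, and the constants 0 and 1 already give
    every word. This is the base case for duality. *)
Lemma RM_zero_vars (s : int) : RM s 0 = if 0 <= s then setT else [set 0].
Proof.
case: s => [r|r] //; apply/setP=> v; rewrite in_setT.
suff [->|->] : v = 0 \/ v = Eval 'X_[0%MM]; first exact: RM0.
  by apply: RM_monomial; rewrite mdeg0.
have [h|h] := F2_eq01 (v 0 0); [left|right]; apply/rowP=> i; rewrite [i]ord1 h.
  by rewrite mxE.
by rewrite mxE mevalX big_ord0.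
Qed.

(** Plotkin's decomposition involves both [s] and [s - 1], so the induction on [m] keeps [s]
    general. Integer orders make the identity hold for every [s], with no boundary cases in the
    inductive step. *)
Lemma dual_RM (m : nat) (s : int) : dual (RM s m) = RM (m%:Z - s - 1) m.
Proof.
elim: m s => [|n IH] s.
  rewrite !RM_zero_vars; case: (lerP 0 s) => hs.
    rewrite ifF; last lia.
    apply/setP=> v; rewrite in_set1; apply/dualP/eqP => [h|-> w _].
      apply/rowP=> i; have := h (const_mx 1) (in_setT _).
      by rewrite /dot big_ord1 !mxE mulr1 [i]ord1.
    exact: dot0l.
  rewrite ifT; last lia.
  by apply/setP=> v; rewrite in_setT; apply/dualP => w /set1P->; apply: dot0r.
have hn : (0 < n.+1)%N by [].
apply/setP=> w; have [a [b ->]] := concatP hn w.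
rewrite RM_concat.
have -> : n.+1%:Z - s - 1 = n%:Z - (s - 1) - 1 by lia.
have -> : n%:Z - (s - 1) - 1 - 1 = n%:Z - s - 1 by lia.
transitivity ((b + a \in RM (n%:Z - s - 1) n)
              && (b \in RM (n%:Z - (s - 1) - 1) n)).
  (* Testing against [(c, c)] constrains [b + a], and testing against [(0, c)] constrains [b]. *)
  rewrite -!IH; apply/dualP/andP => [h|[/dualP h1 /dualP h2] x].
    split; apply/dualP=> c hc.
      have := h (concat hn c c); rewrite RM_concat subrr RM0 hc dot_concat.
      by rewrite dotDl addrC; apply.
    have := h (concat hn 0 c); rewrite RM_concat subr0 RM0 hc dot_concat.
    by rewrite dot0r add0r; apply.
  have [c [d ->]] := concatP hn x; rewrite RM_concat dot_concat => /andP[hc hd].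
  (* Both orthogonality relations contain [dot b c]. Cancelling it leaves [dot a c = dot b d], and
     equal terms add up to 0. *)
  have := h2 _ hd; rewrite oppv_F2 dotDr => e.
  have := h1 _ hc; rewrite dotDl -e => /eqP.
  by rewrite [eqbRHS]addrC (inj_eq (addrI _)) => /eqP->;
    rewrite addrr_pchar2 ?pchar_Fp.
rewrite oppv_F2 andbC; apply: andb_id2r => h.
(* The tests constrain [b] where Plotkin's form constrains [a]. As [b + a] lies in the larger code
   too, either half may be used. *)
have hb : b + a \in RM (n%:Z - (s - 1) - 1) n by apply: RM_mono h; lia.
apply/idP/idP => h'.
  by have := RMD hb h'; rewrite addrAC addvv_F2 add0r.
by have := RMD hb h'; rewrite -addrA addvv_F2 addr0.
Qed.

(** * Coset representatives *)

Section Transversal.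
Variables (n : nat) (G H : {set 'rV['F_2]_n}).
Hypotheses (H0 : 0 \in H) (HB : {in H &, forall x y, x - y \in H}).
Variable U : {set 'rV['F_2]_n}.
Hypothesis trU : is_transversal U (coset_partition G H) G.

Let equivH : {in G & &, equivalence_rel [rel u v | u - v \in H]}.
Proof.
move=> x y z _ _ _ /=; rewrite subrr; split=> // hxy; apply/idP/idP => h.
  have -> : y - z = (x - z) - (x - y) by rewrite opprB [RHS]addrC subrKA.
  exact: HB.
have -> : x - z = (x - y) - (0 - (y - z)) by rewrite sub0r opprK subrKA.
by apply: HB => //; apply: HB.
Qed.

Let pblock_coset :
  {in G &, forall x y, (y \in pblock (coset_partition G H) x) = (x - y \in H)}.
Proof. exact: (pblock_equivalence_partition equivH). Qed.

Let transversal_partition : partition (coset_partition G H) G.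
Proof. by case/and3P: trU. Qed.

Lemma transversal_subset : {subset U <= G}.
Proof. by apply/subsetP; case/and3P: trU. Qed.

(** The representative is the element of [U] in the block of [x]. With [transversal_inj], this makes
    the decomposition of [x] as a representative plus an element of [H] unique. *)
Lemma transversal_coset x : x \in G -> exists2 u, u \in U & x - u \in H.
Proof.
move=> Gx; have /and3P[/eqP covP _ _] := transversal_partition.
have Px : pblock (coset_partition G H) x \in coset_partition G H.
  by rewrite pblock_mem ?covP.
pose u := transversal_repr 0 U (pblock (coset_partition G H) x).
have Uu : u \in U by apply: (repr_mem_transversal trU).
exists u; first exact: Uu.
have: u \in pblock (coset_partition G H) x := repr_mem_pblock trU 0 Px.
by rewrite pblock_coset //; apply: transversal_subset.
Qed.

Lemma transversal_inj : {in U &, forall u v, u - v \in H -> u = v}.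
Proof.
move=> u v Uu Uv huv; apply: (pblock_inj trU) => //.
have Gu := transversal_subset Uu; have Gv := transversal_subset Uv.
have /and3P[/eqP covP triP _] := transversal_partition.
apply/eqP; rewrite eq_pblock ?covP //.
by rewrite pblock_coset.
Qed.

End Transversal.

(** * Tensor products of code states *)

Section States.
Variables (C : numClosedFieldType) (n : nat) (hn : (0 < n.+1)%N).

Lemma tensor_halvesE (psi phi : state C (2 ^ n)) (a b : 'rV['F_2]_(2 ^ n)) :
  @tensor_halves C n.+1 hn psi phi (concat hn a b) = psi a * phi b.
Proof.
rewrite !ffunE (_ : castmx _ (concat hn a b) = row_mx a b).
  by rewrite row_mxKl row_mxKr.
exact: (castmxK (erefl 1%N) (halves hn)).
Qed.

(** Amplitudes are compared at words [(x1, x2)]: the indicator of a pair of words is the product of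
    two indicators, and the product of the two sums expands. *)
Lemma tensor_halves_qrm_ket (r : int) (a b : 'rV['F_2]_(2 ^ n)) :
  let H := dual (RM r n) in
  @tensor_halves C n.+1 hn (qrm_ket C r a) (qrm_ket C r b)
    = ((sqrtC #|H|%:R)^-1 * (sqrtC #|H|%:R)^-1)
      *: \sum_(c in H) \sum_(d in H) ket C (concat hn (a + c) (b + d)).
Proof.
move=> H; apply/ffunP=> x; have [x1 [x2 ->]] := concatP hn x.
rewrite tensor_halvesE !ffunE !sum_ffunE /GRing.scale /= mulrACA.
congr (_ * _); rewrite mulr_suml; apply: eq_bigr => c _.
rewrite sum_ffunE mulr_sumr; apply: eq_bigr => d _.
by rewrite !ffunE concat_eq -natrM mulnb.
Qed.

End States.

(** * Coset decomposition of the dual code, and of the codewords *)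

(** By Plotkin's decomposition, the halves of a codeword lie in one coset of the smaller code; [u]
    is the representative of that coset. *)
Lemma RM_imset_transversal (n : nat) (hn : (0 < n.+1)%N) (s : int)
    (U : {set 'rV['F_2]_(2 ^ n)}) :
  is_transversal U (coset_partition (RM s n) (RM (s - 1) n)) (RM s n) ->
  RM s n.+1 = [set concat hn (p.1 + p.2.1) (p.1 + p.2.2)
              | p in setX U (setX (RM (s - 1) n) (RM (s - 1) n))].
Proof.
move=> trU; apply/setP=> w; have [a [b ->]] := concatP hn w.
rewrite RM_concat; apply/andP/imsetP=> [[ha hb]|[[u [c d]]]].
  have [u Uu hu] := transversal_coset (RM0 _ _) (@RMB _ _) trU ha.
  exists (u, (a - u, b - u)); last by rewrite /= !addrA ![u + _]addrC !addrK.
  rewrite !in_setX Uu hu /=.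
  by have := RMD hb hu; rewrite subrKA.
rewrite !in_setX /= => /and3P[Uu hc hd] /concat_inj[-> ->].
have Ku := transversal_subset trU Uu.
split; first by apply: RMD => //; apply: RM_mono hc; lia.
by rewrite opprD addrACA subrr add0r; apply: RMB.
Qed.

(** The first half determines the coset, hence [u]; cancelling [u] recovers [c] and [d]. This allows
    both counting the dual code and reindexing the sum over it. *)
Lemma concat_transversal_inj (n : nat) (hn : (0 < n.+1)%N) (s : int)
    (U : {set 'rV['F_2]_(2 ^ n)}) :
  is_transversal U (coset_partition (RM s n) (RM (s - 1) n)) (RM s n) ->
  {in setX U (setX (RM (s - 1) n) (RM (s - 1) n)) &,
    injective (fun p => concat hn (p.1 + p.2.1) (p.1 + p.2.2))}.
Proof.
move=> trU [u [c d]] [v [c' d']]; rewrite !in_setX /=.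
move=> /and3P[Uu hc hd] /and3P[Uv hc' hd'] /concat_inj[ec ed].
have e : u = v.
  apply: (transversal_inj (RM0 _ _) (@RMB _ _) trU) => //.
  have -> : u - v = c' - c; last exact: RMB.
  by apply/eqP; rewrite subr_eq addrAC [c' + v]addrC -ec addrK.
by move: ec ed; rewrite e => /addrI-> /addrI->.
Qed.

Theorem theorem1 (C : numClosedFieldType) (m r : nat) (hm : (0 < m)%N)
    (hr : (uphalf m.-1 <= r < m)%N) :
  (forall w : 'rV['F_2]_(2 ^ m), w \in RM r m ->
     exists w1 w2 : 'rV['F_2]_(2 ^ m.-1),
       [/\ w1 \in RM r m.-1, w2 \in RM r m.-1 & w = concat hm w1 w2])
  /\
  (forall w1 w2 : 'rV['F_2]_(2 ^ m.-1),
     w1 \in RM r m.-1 -> w2 \in RM r m.-1 ->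
     concat hm w1 w2 \in RM r m ->
     let K := RM (m%:Z - r%:Z - 1) m.-1 in
     let B := coset_partition K (RM (m%:Z - r%:Z - 2) m.-1) in
     forall U : {set 'rV['F_2]_(2 ^ m.-1)}, is_transversal U B K ->
       (forall u : 'rV['F_2]_(2 ^ m.-1), u \in U ->
          [/\ w1 + u \in RM r m.-1, w2 + u \in RM r m.-1,
              qrm_ket C r (w1 + u) \in QRM C r m.-1
            & qrm_ket C r (w2 + u) \in QRM C r m.-1])
       /\ qrm_ket C r (concat hm w1 w2) =
          (sqrtC #|B|%:R)^-1 *:
          \sum_(u in U) tensor_halves hm (qrm_ket C r (w1 + u))
                                         (qrm_ket C r (w2 + u))).
Proof.
case: m hm hr => [//|n] hm hr.
(* The lower bound on [r] amounts to [n - r <= r], so shifting by a representative stays inside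
   [RM r n]. *)
have sub : {subset RM (n.+1%:Z - r%:Z - 1) n <= RM r n}.
  by apply: RM_mono; move: hr; lia.
split=> [w|w1 w2 hw1 hw2 _ K B U trU].
  have [a [b ->]] := concatP hm w; rewrite RM_concat => /andP[ha hb].
  exists a, b; split=> //; rewrite -(subrK a b); apply: RMD ha.
  by apply: RM_mono hb; lia.
have eK : n.+1%:Z - r%:Z - 2 = n.+1%:Z - r%:Z - 1 - 1 by lia.
have dualH : dual (RM r n) = RM (n.+1%:Z - r%:Z - 2) n.
  by rewrite dual_RM; congr (RM _ n); lia.
split=> [u Uu|].
  have Ku := sub _ (transversal_subset trU Uu).
  have hw w : w \in RM r n -> w + u \in RM r n by move=> ?; apply: RMD.
  by split; rewrite ?hw //; apply/memv_span/image_f/hw.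
have cardU : #|U| = #|B| := card_transversal trU.
rewrite /B /K eK in trU cardU *; rewrite /= in trU cardU *.
under [in RHS]eq_bigr do rewrite tensor_halves_qrm_ket dualH eK.
rewrite /qrm_ket dual_RM (RM_imset_transversal hm trU).
rewrite card_in_imset; last exact: concat_transversal_inj.
rewrite big_imset; last exact: concat_transversal_inj.
(* The dual code has [#|B|] times the squared size of the smaller code as its cardinality. The
   square root is multiplicative on nonnegative numbers, so the normalisation splits into the outer
   factor and one factor per half. *)
rewrite !cardsX cardU !natrM sqrtCM ?nnegrE ?mulr_ge0 ?ler0n //.
rewrite sqrtCM ?nnegrE ?ler0n // !invfM -scalerA; congr (_ *: _).
rewrite -scaler_sumr; congr (_ *: _).
(* Flattening the nested sums gives the same triples [(u, (c, d))] as on the left. *)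
under [RHS]eq_bigr => u _ do rewrite pair_big /=.
rewrite pair_big /=; apply: eq_big => [[u [c d]]|[u [c d]] _] /=.
  by rewrite !in_setX.
by rewrite -concatD !addrA.
Qed.
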